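(* Let $M\subseteq\mathbb R^4$ be a connected open set with coordinates $(x,r,x^3,x^4)$, let $H(x,x^3,x^4)=a_1(x^3)^2+a_2(x^4)^2+a_3x^3x^4+a_4x^3+a_5x^4+a_6$, where the $a_i$ are scalars, and let $g$ be the generalized plane wave metric $$ds^2=2H\,(dx)^2+2\,dx\,dr+(dx^3)^2+(dx^4)^2.$$ Then: (i) the following curvature conditions hold, with associated 1-forms of the corresponding structures depending on this metric: $\kappa=0$, $R=W$ and $C=K$; $(M,g)$ is an $R$-space and a $C$-space by Venzi for $\{1,0,0,0\}$ and the curvature 2-forms $\Omega_{(R)l}^m$ are recurrent for $\{1,0,0,0\}$; it is semisymmetric ($R\cdot R=0$), hence $R\cdot S=0$, $R\cdot C=0$, $R\cdot P=0$; if $4H_{34}^2+(H_{33}-H_{44})^2\neq0$, the conformal curvature 2-forms $\Omega_{(C)l}^m$ are recurrent for some 1-form; if $H_{33}+H_{44}\neq0$, it is Ricci recurrent, weakly Ricci symmetric and weakly cyclic Ricci symmetric for suitable associated 1-forms; $S=\alpha\,\eta\otimes\eta$ for a scalar $\alpha$ and $\eta=\{1,0,0,0\}$, with $\|\eta\|=0$, $\nabla\eta=0$, $S\wedge S=0$ and $S^2=0$; $Q(S,R)=Q(S,C)=0$, but $R$ or $C$ is not a scalar multiple of $S\wedge S$, as $S$ is of rank 1; (ii) moreover it is locally symmetric ($\nabla R=0$) and hence Ricci symmetric ($\nabla S=0$), conformally symmetric ($\nabla C=0$) and projectively symmetric ($\nabla P=0$).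
   Context: Coordinates $(x,r,x^3,x^4)$ are numbered $1,2,3,4$; a double subscript on $H$ denotes second partial derivatives with respect to the coordinates so numbered. A 1-form is written by its components $\{\cdot,\cdot,\cdot,\cdot\}$ in the coordinate coframe. Sign conventions: $\mathcal R(X,Y)Z=\nabla_Y\nabla_XZ-\nabla_X\nabla_YZ+\nabla_{[X,Y]}Z$ ($\nabla$ Levi-Civita), $R(X_1,X_2,X_3,X_4)=g(\mathcal R(X_1,X_2)X_3,X_4)$, $S(Y,Z)=\operatorname{tr}(X\mapsto\mathcal R(X,Y)Z)$, i.e. $S_{jk}=g^{il}R_{ijkl}$; $g(\mathcal SX,Y)=S(X,Y)$; $S^2(X,Y)=S(\mathcal SX,Y)$; $\kappa=\operatorname{tr}\mathcal S$. Kulkarni-Nomizu product: $(A\wedge E)(X_1,X_2,X_3,X_4)=A(X_1,X_4)E(X_2,X_3)+A(X_2,X_3)E(X_1,X_4)-A(X_1,X_3)E(X_2,X_4)-A(X_2,X_4)E(X_1,X_3)$. In dimension 4: conformal tensor $C=R-\frac12g\wedge S+\frac{\kappa}{12}g\wedge g$; concircular tensor $W=R-\frac{\kappa}{24}g\wedge g$; conharmonic tensor $K=R-\frac12g\wedge S$; projective tensor $P(X_1,X_2,X_3,X_4)=R(X_1,X_2,X_3,X_4)-\frac13[g(X_1,X_4)S(X_2,X_3)-g(X_2,X_4)S(X_1,X_3)]$. For a $(0,4)$-tensor $D$, $\mathcal D$ is given by $D(X_1,X_2,X_3,X_4)=g(\mathcal D(X_1,X_2)X_3,X_4)$. For a $(0,k)$-tensor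 $B$, $(D\cdot B)(X_1,\dots,X_k,X,Y)=-B(\mathcal D(X,Y)X_1,\dots,X_k)-\cdots-B(X_1,\dots,\mathcal D(X,Y)X_k)$. For symmetric $(0,2)$ $A$: $(X\wedge_AY)Z=A(Y,Z)X-A(X,Z)Y$ and $Q(A,B)(X_1,\dots,X_k,X,Y)=-B((X\wedge_AY)X_1,\dots,X_k)-\cdots-B(X_1,\dots,(X\wedge_AY)X_k)$. Ricci recurrent with 1-form $\Pi$ means $\nabla_XS=\Pi(X)S$. $(M,g)$ is a $D$-space by Venzi for a nonzero 1-form $\Theta$ if $\Theta(X_1)D(X_2,X_3,X_4,X_5)+\Theta(X_2)D(X_3,X_1,X_4,X_5)+\Theta(X_3)D(X_1,X_2,X_4,X_5)=0$. The curvature 2-forms $\Omega_{(D)l}^m$ are recurrent for $\Pi$ if the cyclic sum over $X_1,X_2,X_3$ of $(\nabla_{X_1}D)(X_2,X_3,X,Y)$ equals the cyclic sum of $\Pi(X_1)D(X_2,X_3,X,Y)$. Weakly Ricci symmetric means $(\nabla_XS)(X_1,X_2)=\Pi(X)S(X_1,X_2)+\Omega(X_1)S(X,X_2)+\Theta(X_2)S(X_1,X)$ for some 1-forms $\Pi,\Omega,\Theta$; weakly cyclic Ricci symmetric means the same with left-hand side replaced by $(\nabla_XS)(X_1,X_2)+(\nabla_{X_1}S)(X,X_2)+(\nabla_{X_2}S)(X_1,X)$.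
   Formalization: ''R or C is not a multiple of S∧S, as S is of rank 1'' fails if a_1=a_2=a_3=0 (R=C=S=0); proved instead: rank S=1 and R no multiple if H_33+H_44≠0; neither R nor C a multiple if 4H_34²+(H_33−H_44)²≠0. *)

(* Defs.v *)
From HB Require Import structures.
From mathcomp Require Import all_boot all_order all_algebra.
From mathcomp Require Import all_classical all_reals all_analysis.
Set Implicit Arguments.
Unset Strict Implicit.
Unset Printing Implicit Defensive.
Import Order.TTheory GRing.Theory Num.Theory.
Import numFieldNormedType.Exports.
Local Open Scope classical_set_scope.
Local Open Scope ring_scope.

(* Points of the coordinate space and tangent vectors
   are both row vectors; a (0,k)-tensor field sends a point to a function of k
   tangent vectors, and a 1-form is given by its row of components. *)
Notation vec R := 'rV[R]_4 (only parsing).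
Notation vfield R := ('rV[R]_4 -> 'rV[R]_4) (only parsing).
Notation oneform R := ('rV[R]_4 -> 'rV[R]_4) (only parsing).
Notation tensor2 R := ('rV[R]_4 -> 'rV[R]_4 -> 'rV[R]_4 -> R) (only parsing).
Notation tensor4 R :=
  ('rV[R]_4 -> 'rV[R]_4 -> 'rV[R]_4 -> 'rV[R]_4 -> 'rV[R]_4 -> R) (only parsing).
Notation gmetric R := ('rV[R]_4 -> 'M[R]_4) (only parsing).

(* c_1, ..., c_4 index the coordinates (x, r, x^3, x^4) as 1, ..., 4. *)
Definition c1 : 'I_4 := @Ordinal 4 0 isT.
Definition c2 : 'I_4 := @Ordinal 4 1 isT.
Definition c3 : 'I_4 := @Ordinal 4 2 isT.
Definition c4 : 'I_4 := @Ordinal 4 3 isT.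

Definition coordv (R : realType) (i : 'I_4) : vec R := delta_mx 0 i.

Definition partial (R : realType) (i : 'I_4) (f : vec R -> R) : vec R -> R :=
  fun p => 'D_(coordv R i) f p.

(* C^oo on the open set M: the iterated partial derivatives of every order
   exist and are continuous at every point of M. *)
Definition iter_partial (R : realType) (s : seq 'I_4) (f : vec R -> R) :
  vec R -> R := foldr (@partial R) f s.

Definition smooth_on (R : realType) (M : set (vec R)) (f : vec R -> R) : Prop :=
  forall (s : seq 'I_4) (p : vec R), M p ->
    {for p, continuous (iter_partial s f)} /\
    (forall i : 'I_4, derivable (iter_partial s f) p (coordv R i)).

Definition smooth_oneform (R : realType) (M : set (vec R)) (w : oneform R) :
  Prop := forall i : 'I_4, smooth_on M (fun p => w p 0 i).

Definition feval (R : realType) (w : oneform R) (p X : vec R) : R :=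
  \sum_(i < 4) w p 0 i * X 0 i.

(* The 1-form {1,0,0,0}, i.e. dx. *)
Definition dxform (R : realType) : oneform R := fun=> coordv R c1.

Implicit Types (R : realType).

Definition gdot R (g : gmetric R) : tensor2 R :=
  fun p X Y => (X *m g p *m Y^T) 0 0.

(* The vector V such that g(V, Z) = f Z for all Z, where f is a linear form. *)
Definition sharp R (g : gmetric R) (p : vec R) (f : vec R -> R) : vec R :=
  (\row_(l < 4) f (coordv R l)) *m invmx (g p).

(* Christoffel map: nabla_X Y at p for the vector fields with constant
   components X and Y, as given by the Koszul formula (the Lie brackets of such
   fields vanish). *)
Definition christoffel R (g : gmetric R) (p X Y : vec R) : vec R :=
  sharp g p (fun Z => 2^-1 * ('D_X (fun q => gdot g q Y Z) p
                            + 'D_Y (fun q => gdot g q X Z) p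
                            - 'D_Z (fun q => gdot g q X Y) p)).

Definition cov R (g : gmetric R) (X Y : vfield R) : vfield R :=
  fun p => 'D_(X p) Y p + christoffel g p (X p) (Y p).

Definition lie R (X Y : vfield R) : vfield R :=
  fun p => 'D_(X p) Y p - 'D_(Y p) X p.

(* Sign convention: R(X,Y)Z = nabla_Y nabla_X Z - nabla_X nabla_Y Z
   + nabla_[X,Y] Z. *)
Definition curv_fields R (g : gmetric R) (X Y Z : vfield R) : vfield R :=
  fun p => cov g Y (cov g X Z) p - cov g X (cov g Y Z) p
         + cov g (lie X Y) Z p.

(* The curvature is tensorial: its value on tangent vectors at p is computed
   with their extensions by constant components. *)
Definition curvop R (g : gmetric R) (p X Y Z : vec R) : vec R :=
  curv_fields g (cst X) (cst Y) (cst Z) p.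

Definition Riem R (g : gmetric R) : tensor4 R :=
  fun p X1 X2 X3 X4 => gdot g p (curvop g p X1 X2 X3) X4.

Definition Ric R (g : gmetric R) : tensor2 R :=
  fun p Y Z => \tr (lin1_mx (fun X => curvop g p X Y Z)).

Definition Ricop R (g : gmetric R) (p X : vec R) : vec R :=
  sharp g p (Ric g p X).

Definition Ric2 R (g : gmetric R) : tensor2 R :=
  fun p X Y => Ric g p (Ricop g p X) Y.

Definition scal R (g : gmetric R) (p : vec R) : R := \tr (lin1_mx (Ricop g p)).

Definition Ric_mx R (g : gmetric R) (p : vec R) : 'M[R]_4 :=
  \matrix_(i, j) Ric g p (coordv R i) (coordv R j).

Definition Kulkarni_Nomizu R (A E : tensor2 R) : tensor4 R := fun p X1 X2 X3 X4 =>
  A p X1 X4 * E p X2 X3 + A p X2 X3 * E p X1 X4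
  - A p X1 X3 * E p X2 X4 - A p X2 X4 * E p X1 X3.

Definition Conformal R (g : gmetric R) : tensor4 R := fun p X1 X2 X3 X4 =>
  Riem g p X1 X2 X3 X4 - 2^-1 * Kulkarni_Nomizu (gdot g) (Ric g) p X1 X2 X3 X4
  + scal g p / 12 * Kulkarni_Nomizu (gdot g) (gdot g) p X1 X2 X3 X4.

Definition Concircular R (g : gmetric R) : tensor4 R := fun p X1 X2 X3 X4 =>
  Riem g p X1 X2 X3 X4
  - scal g p / 24 * Kulkarni_Nomizu (gdot g) (gdot g) p X1 X2 X3 X4.

Definition Conharmonic R (g : gmetric R) : tensor4 R := fun p X1 X2 X3 X4 =>
  Riem g p X1 X2 X3 X4 - 2^-1 * Kulkarni_Nomizu (gdot g) (Ric g) p X1 X2 X3 X4.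

Definition Projective R (g : gmetric R) : tensor4 R := fun p X1 X2 X3 X4 =>
  Riem g p X1 X2 X3 X4
  - 3^-1 * (gdot g p X1 X4 * Ric g p X2 X3 - gdot g p X2 X4 * Ric g p X1 X3).

(* The endomorphism with g(endo D X Y Z, V) = D(X, Y, Z, V). *)
Definition endo R (g : gmetric R) (D : tensor4 R) (p X Y Z : vec R) : vec R :=
  sharp g p (D p X Y Z).

(* The (0,k+2)-tensor D . B for k = 2 and k = 4; the last two arguments are
   those fed to the endomorphism of D. *)
Definition act2 R (g : gmetric R) (D : tensor4 R) (B : tensor2 R) : tensor4 R :=
  fun p X1 X2 X Y =>
    - B p (endo g D p X Y X1) X2 - B p X1 (endo g D p X Y X2).

Definition act4 R (g : gmetric R) (D B : tensor4 R)
    (p X1 X2 X3 X4 X Y : vec R) : R :=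
  - B p (endo g D p X Y X1) X2 X3 X4 - B p X1 (endo g D p X Y X2) X3 X4
  - B p X1 X2 (endo g D p X Y X3) X4 - B p X1 X2 X3 (endo g D p X Y X4).

Definition wedgeop R (A : tensor2 R) (p X Y Z : vec R) : vec R :=
  A p Y Z *: X - A p X Z *: Y.

(* Q(A, B) for a (0,4)-tensor B. *)
Definition Tachibana4 R (A : tensor2 R) (B : tensor4 R)
    (p X1 X2 X3 X4 X Y : vec R) : R :=
  - B p (wedgeop A p X Y X1) X2 X3 X4 - B p X1 (wedgeop A p X Y X2) X3 X4
  - B p X1 X2 (wedgeop A p X Y X3) X4 - B p X1 X2 X3 (wedgeop A p X Y X4).

(* Covariant derivatives, the first vector being the direction:
   (nabla_X B)(X1, ...) = X(B(X1, ...)) - B(nabla_X X1, ...) - ...,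
   with X1, ... extended by constant components. *)
Definition nabla1 R (g : gmetric R) (w : oneform R) : tensor2 R :=
  fun p X X1 => 'D_X (fun q => feval w q X1) p - feval w p (christoffel g p X X1).

Definition nabla2 R (g : gmetric R) (B : tensor2 R) (p X X1 X2 : vec R) : R :=
  'D_X (fun q => B q X1 X2) p
  - B p (christoffel g p X X1) X2 - B p X1 (christoffel g p X X2).

Definition nabla4 R (g : gmetric R) (B : tensor4 R)
    (p X X1 X2 X3 X4 : vec R) : R :=
  'D_X (fun q => B q X1 X2 X3 X4) p
  - B p (christoffel g p X X1) X2 X3 X4 - B p X1 (christoffel g p X X2) X3 X4
  - B p X1 X2 (christoffel g p X X3) X4 - B p X1 X2 X3 (christoffel g p X X4).

(* Length of a 1-form for a possibly indefinite metric. *)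
Definition fnorm R (g : gmetric R) (w : oneform R) (p : vec R) : R :=
  Num.sqrt `| (w p *m invmx (g p) *m (w p)^T) 0 0 |.

Definition venzi_space R (M : set (vec R)) (D : tensor4 R) (T : oneform R) :
    Prop :=
  [/\ smooth_oneform M T, (exists2 p, M p & T p != 0) &
    forall p, M p -> forall X1 X2 X3 X4 X5 : vec R,
      feval T p X1 * D p X2 X3 X4 X5 + feval T p X2 * D p X3 X1 X4 X5
      + feval T p X3 * D p X1 X2 X4 X5 = 0].

Definition recurrent_2forms R (M : set (vec R)) (g : gmetric R)
    (D : tensor4 R) (Pi : oneform R) : Prop :=
  smooth_oneform M Pi /\
  forall p, M p -> forall X1 X2 X3 X Y : vec R,
    nabla4 g D p X1 X2 X3 X Y + nabla4 g D p X2 X3 X1 X Y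
    + nabla4 g D p X3 X1 X2 X Y
    = feval Pi p X1 * D p X2 X3 X Y + feval Pi p X2 * D p X3 X1 X Y
    + feval Pi p X3 * D p X1 X2 X Y.

Definition ricci_recurrent R (M : set (vec R)) (g : gmetric R)
    (Pi : oneform R) : Prop :=
  smooth_oneform M Pi /\
  forall p, M p -> forall X X1 X2 : vec R,
    nabla2 g (Ric g) p X X1 X2 = feval Pi p X * Ric g p X1 X2.

Definition weakly_ricci_symmetric R (M : set (vec R)) (g : gmetric R)
    (Pi Om T : oneform R) : Prop :=
  [/\ smooth_oneform M Pi, smooth_oneform M Om, smooth_oneform M T &
    forall p, M p -> forall X X1 X2 : vec R,
      nabla2 g (Ric g) p X X1 X2
      = feval Pi p X * Ric g p X1 X2 + feval Om p X1 * Ric g p X X2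
      + feval T p X2 * Ric g p X1 X].

Definition weakly_cyclic_ricci_symmetric R (M : set (vec R)) (g : gmetric R)
    (Pi Om T : oneform R) : Prop :=
  [/\ smooth_oneform M Pi, smooth_oneform M Om, smooth_oneform M T &
    forall p, M p -> forall X X1 X2 : vec R,
      nabla2 g (Ric g) p X X1 X2 + nabla2 g (Ric g) p X1 X X2
      + nabla2 g (Ric g) p X2 X1 X
      = feval Pi p X * Ric g p X1 X2 + feval Om p X1 * Ric g p X X2
      + feval T p X2 * Ric g p X1 X].

Definition scalar_multiple_on R (M : set (vec R)) (A B : tensor4 R) : Prop :=
  exists f : vec R -> R, forall p, M p -> forall X1 X2 X3 X4 : vec R,
    A p X1 X2 X3 X4 = f p * B p X1 X2 X3 X4.

Definition wave_metric (R : realType) (H : vec R -> R) : gmetric R := fun p =>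
  (2 * H p) *: delta_mx c1 c1 + delta_mx c1 c2 + delta_mx c2 c1
  + delta_mx c3 c3 + delta_mx c4 c4.

Definition waveH (R : realType) (a1 a2 a3 a4 a5 a6 : R) : vec R -> R := fun p =>
  a1 * p 0 c3 ^+ 2 + a2 * p 0 c4 ^+ 2 + a3 * p 0 c3 * p 0 c4
  + a4 * p 0 c3 + a5 * p 0 c4 + a6.

Definition partial2 (R : realType) (i j : 'I_4) (f : vec R -> R) : vec R -> R :=
  partial j (partial i f).

(* Main.v *)
Require Import Defs.
From HB Require Import structures.
From mathcomp Require Import all_boot all_order all_algebra.
From mathcomp Require Import all_classical all_reals all_analysis.
From mathcomp Require Import ring.
Import Order.TTheory GRing.Theory Num.Theory.
Import numFieldNormedType.Exports.
Local Open Scope classical_set_scope.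
Local Open Scope ring_scope.

(** Let u = dx, and let h be the Hessian of H in the transverse coordinates
    (x^3, x^4), a constant symmetric form because H is quadratic.  The
    Christoffel map is u(X) dH(Y) + u(Y) dH(X) along the null vector d/dr, minus
    u(X) u(Y) grad H in the transverse plane ([christoffelE]).  Both terms lie
    in the kernel of u, and the quadratic part of the curvature cancels by
    symmetry; what is left is
      R = (u tensor u) wedge h,
    a tensor with constant components ([RiemE]).  Hence
    S = (tr h) u tensor u ([RicE]); as u is null, kappa = 0 and S^2 = 0, and
    S wedge S = 0 because S has rank at most one.  Subtracting half of g wedge S
    from R replaces h by its trace-free part ([ConformalE]).

    Thus R and C are both of the form (u tensor u) wedge beta, with beta a
    constant form on the transverse plane ([wave_tensor]), and each property is
    proved once for all such tensors.  Antisymmetrizing with a further u gives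
    zero: this is the Venzi condition.  Let E be an endomorphism with values in
    the kernel of u and such that the transverse part of E Z is u(Z) times a
    fixed vector.  As a derivation E kills u and turns beta into a symmetrized
    product of u and a covector, whose product with u tensor u is zero.  The
    Christoffel map, the curvature operators and the operators in Q(S, .) are
    all of this kind, whence nabla R = nabla C = 0, R.R = R.C = 0 and
    Q(S, R) = Q(S, C) = 0.  The projective tensor is treated separately, but its
    components are constant too ([ProjectiveE]).

    As nabla S = 0, the recurrence conditions on S hold with zero 1-forms; and
    since R and C are parallel and satisfy the Venzi condition, their curvature
    2-forms are recurrent for dx.  Finally S wedge S = 0, so R or C is a
    multiple of it only if R or C is zero, which forces beta = 0
    ([wave_tensor_eq0]). *)

(** * Derivatives of quadratic maps *)

(** Every map differentiated below (H, dH, the metric, the Christoffel map and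
    constants) is at most quadratic in the coordinates, so that its directional
    derivative is read off from an exact second-order expansion; this serves
    scalar and vector-valued maps at once. *)
Lemma is_derive_quadratic (R : realType) (V W : normedModType R) (f : V -> W)
    (p v : V) (d e : W) :
  (forall h : R, f (h *: v + p) = f p + h *: d + h ^+ 2 *: e) ->
  is_derive p v f d.
Proof.
move=> fE.
have lim_d : h^-1 *: ((f \o shift p) (h *: v) - f p) @[h --> 0^'] --> d.
  have affine_d : (d + h *: e) @[h --> (0 : R)^'] --> d.
    rewrite -[X in _ --> X]addr0 -[X in _ --> _ + X](scale0r e).
    apply: cvgD; first exact: cvg_cst.
    by apply: cvgZr_tmp; exact: nbhs_dnbhs.
  apply: cvg_trans affine_d; apply: near_eq_cvg.
  near=> h.
  have h0 : h != 0 by near: h; exact: nbhs_dnbhs_neq.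
  rewrite /= fE -[f p + _ + _]addrA [f p + _]addrC addrK.
  by rewrite scalerDr !scalerA mulVf// scale1r expr2 mulKf.
apply: DeriveDef; first by apply/cvg_ex; exists d.
exact/cvg_lim.
Unshelve. all: by end_near. Qed.

Lemma derive_quadratic (R : realType) (f : 'rV[R]_4 -> R) (p v : 'rV[R]_4)
    (d e : R) :
  (forall h, f (h *: v + p) = f p + h * d + h ^+ 2 * e) -> 'D_v f p = d.
Proof.
by move=> fE; case: (@is_derive_quadratic R _ R f p v d e fE).
Qed.

(** * Coordinates and linear algebra in dimension four *)

Definition row4 {R : realType} (a b c d : R) : 'rV[R]_4 :=
  \row_(j < 4) [:: a; b; c; d]`_j.

Lemma row4E (R : realType) (a b c d : R) :
  (row4 a b c d 0 c1 = a) * (row4 a b c d 0 c2 = b)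
  * (row4 a b c d 0 c3 = c) * (row4 a b c d 0 c4 = d).
Proof. by rewrite /row4 !mxE. Qed.

Lemma coordvE (R : realType) :
  (coordv R c1 = row4 1 0 0 0) * (coordv R c2 = row4 0 1 0 0)
  * (coordv R c3 = row4 0 0 1 0) * (coordv R c4 = row4 0 0 0 1).
Proof.
by do 3?split; apply/rowP => j; rewrite !mxE; case: j => [[|[|[|[|]]]]].
Qed.

Lemma row4P (R : realType) (X Y : 'rV[R]_4) :
  X 0 c1 = Y 0 c1 -> X 0 c2 = Y 0 c2 -> X 0 c3 = Y 0 c3 -> X 0 c4 = Y 0 c4 ->
  X = Y.
Proof.
move=> e1 e2 e3 e4; apply/rowP => -[[|[|[|[|//]]]] j4].
- by have -> : Ordinal j4 = c1 by exact/val_inj.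
- by have -> : Ordinal j4 = c2 by exact/val_inj.
- by have -> : Ordinal j4 = c3 by exact/val_inj.
- by have -> : Ordinal j4 = c4 by exact/val_inj.
Qed.

Lemma sum4 (V : nmodType) (F : 'I_4 -> V) :
  \sum_(i < 4) F i = F c1 + F c2 + F c3 + F c4.
Proof.
rewrite !big_ord_recl big_ord0 addr0 !addrA.
by congr (F _ + F _ + F _ + F _); exact/val_inj.
Qed.

Lemma gdotE (R : realType) (H : 'rV[R]_4 -> R) (p X Y : 'rV[R]_4) :
  gdot (wave_metric H) p X Y
  = 2 * H p * X 0 c1 * Y 0 c1 + X 0 c1 * Y 0 c2 + X 0 c2 * Y 0 c1
    + X 0 c3 * Y 0 c3 + X 0 c4 * Y 0 c4.
Proof.
by rewrite /gdot /wave_metric mxE sum4 !mxE !sum4 !mxE /=; ring.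
Qed.

Lemma wave_invmx (R : realType) (H : 'rV[R]_4 -> R) (p : 'rV[R]_4) :
  invmx (wave_metric H p)
  = delta_mx c1 c2 + delta_mx c2 c1 - (2 * H p) *: delta_mx c2 c2
    + delta_mx c3 c3 + delta_mx c4 c4.
Proof.
set B := RHS.
have gB : B *m wave_metric H p = 1%:M.
  apply/matrixP => i j; rewrite mxE sum4 !mxE.
  by case: i => [[|[|[|[|//]]]] ?]; case: j => [[|[|[|[|//]]]] ?];
    rewrite -?val_eqE /=; ring.
have [_ unit_g] := mulmx1_unit gB.
by rewrite -[LHS]mul1mx -gB -mulmxA mulmxV// mulmx1.
Qed.

Lemma sharpE (R : realType) (H : 'rV[R]_4 -> R) (p : 'rV[R]_4)
    (f : 'rV[R]_4 -> R) :
  sharp (wave_metric H) p f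
  = row4 (f (coordv R c2)) (f (coordv R c1) - 2 * H p * f (coordv R c2))
         (f (coordv R c3)) (f (coordv R c4)).
Proof.
rewrite /sharp wave_invmx.
by apply: row4P; rewrite row4E !mxE sum4 !mxE /=; ring.
Qed.

Lemma trace_lin1_mx (R : realType) (f : 'rV[R]_4 -> 'rV[R]_4) :
  \tr (lin1_mx f)
  = f (coordv R c1) 0 c1 + f (coordv R c2) 0 c2
    + f (coordv R c3) 0 c3 + f (coordv R c4) 0 c4.
Proof. by rewrite /mxtrace sum4 /lin1_mx !mxE. Qed.

(** * Constant 1-forms and scalars *)

Lemma feval_dx (R : realType) (p X : 'rV[R]_4) :
  feval (@dxform R) p X = X 0 c1.
Proof. by rewrite /feval sum4 /dxform coordvE !row4E; ring. Qed.

Lemma feval0 (R : realType) (p X : 'rV[R]_4) : feval (cst 0) p X = 0.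
Proof. by rewrite /feval big1// => i _; rewrite mxE mul0r. Qed.

Lemma smooth_cst (R : realType) (M : set 'rV[R]_4) (c : R) :
  smooth_on M (cst c).
Proof.
move=> s p _.
have [c' ->] : exists c', iter_partial s (cst c) = cst c'.
  elim: s => [|i s [c' IHs]]; first by exists c.
  exists 0; apply/funext => q.
  rewrite [LHS]/(partial i (iter_partial s (cst c)) q) IHs.
  exact: derive_cst.
by split=> [|i]; [exact: cst_continuous | exact: derivable_cst].
Qed.

Lemma smooth_oneform_cst (R : realType) (M : set 'rV[R]_4) (w : 'rV[R]_4) :
  smooth_oneform M (cst w).
Proof. by move=> i; exact: smooth_cst. Qed.

(** * Christoffel map and curvature *)

(** A symmetric form on the (x^3, x^4)-plane, extended by zero; the Hessian of H
    and its trace-free part are the two cases of interest. *)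
Definition transverse {R : realType} (b33 b44 b34 : R) (X Y : 'rV[R]_4) : R :=
  b33 * X 0 c3 * Y 0 c3 + b44 * X 0 c4 * Y 0 c4
  + b34 * (X 0 c3 * Y 0 c4 + X 0 c4 * Y 0 c3).

(** The bracket of constant fields vanishes, so the Lie term is nabla_0 Z, of
    which only the Christoffel part is left. *)
Lemma curvop_christoffel (R : realType) (g : 'rV[R]_4 -> 'M[R]_4)
    (p X Y Z : 'rV[R]_4) :
  curvop g p X Y Z
  = 'D_Y (fun q => christoffel g q X Z) p
    + christoffel g p Y (christoffel g p X Z)
    - ('D_X (fun q => christoffel g q Y Z) p
       + christoffel g p X (christoffel g p Y Z))
    + christoffel g p 0 Z.
Proof.
have cov_cst U : cov g U (cst Z) = fun q => christoffel g q (U q) Z.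
  by apply/funext => q; rewrite /cov derive_cst add0r.
(* The inner covariant derivative is replaced as a field, since the outer one
   differentiates it. *)
have cov_cov U V : cov g (cst U) (cov g (cst V) (cst Z)) p
    = 'D_U (fun q => christoffel g q V Z) p
      + christoffel g p U (christoffel g p V Z).
  exact: (congr1 (fun F => 'D_U F p + christoffel g p U (F p))
            (cov_cst (cst V))).
have cov_lie : cov g (lie (cst X) (cst Y)) (cst Z) p = christoffel g p 0 Z.
  apply: etrans (congr1 (@^~ p) (cov_cst (lie (cst X) (cst Y)))) _.
  by rewrite /lie !derive_cst subrr.
exact: (congr2 +%R (congr2 (fun F G => F - G) (cov_cov Y X) (cov_cov X Y))
          cov_lie).
Qed.

Section GeneralizedPlaneWave.
Context {R : realType} (a1 a2 a3 a4 a5 a6 : R).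
Implicit Types p q X Y Z : 'rV[R]_4.

Local Notation H := (waveH a1 a2 a3 a4 a5 a6).
Local Notation g := (wave_metric H).
Local Notation b := (transverse (2 * a1) (2 * a2) a3).

Definition dH (p Z : 'rV[R]_4) : R :=
  (2 * a1 * p 0 c3 + a3 * p 0 c4 + a4) * Z 0 c3
  + (2 * a2 * p 0 c4 + a3 * p 0 c3 + a5) * Z 0 c4.

Lemma derive_waveH p Z : 'D_Z H p = dH p Z.
Proof.
(* The second-order term is the homogeneous quadratic part of H at Z. *)
apply: (@derive_quadratic _ _ _ _ _ (waveH a1 a2 a3 0 0 0 Z)) => h.
by rewrite /waveH /dH !mxE; ring.
Qed.

Lemma derive_dH p X Z : 'D_X (fun q => dH q Z) p = b X Z.
Proof.
apply: (@derive_quadratic _ _ _ _ _ 0) => h.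
by rewrite /transverse /dH !mxE; ring.
Qed.

Lemma derive_gdot p X Y Z :
  'D_Z (fun q => gdot g q X Y) p = 2 * dH p Z * X 0 c1 * Y 0 c1.
Proof.
apply: (@derive_quadratic _ _ _ _ _
  (2 * waveH a1 a2 a3 0 0 0 Z * X 0 c1 * Y 0 c1)) => h.
by rewrite !gdotE /waveH /dH !mxE; ring.
Qed.

(** The dx-component vanishes: this is what makes dx parallel and keeps all the
    later derivations inside the kernel of dx. *)
Lemma christoffelE p X Y :
  christoffel g p X Y
  = row4 0
      (dH p X * Y 0 c1 + dH p Y * X 0 c1)
      (- (dH p (coordv R c3) * X 0 c1 * Y 0 c1))
      (- (dH p (coordv R c4) * X 0 c1 * Y 0 c1)).
Proof.
rewrite /christoffel sharpE !derive_gdot /dH !coordvE !row4E.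
by congr row4; field.
Qed.

Lemma derive_christoffel p X Y Z :
  'D_Z (fun q => christoffel g q X Y) p
  = row4 0
      (b Z X * Y 0 c1 + b Z Y * X 0 c1)
      (- (b Z (coordv R c3) * X 0 c1 * Y 0 c1))
      (- (b Z (coordv R c4) * X 0 c1 * Y 0 c1)).
Proof.
set D := RHS; suff [] : is_derive p Z (fun q => christoffel g q X Y) D by [].
apply: (@is_derive_quadratic _ _ _ _ _ _ _ 0) => h; rewrite /D {D}.
rewrite !christoffelE !coordvE.
by apply: row4P; rewrite !(mxE, row4E) /transverse /dH !(mxE, row4E) /=; ring.
Qed.

(** The products of Christoffel maps cancel: nabla_Y (nabla_X Z) contributes
    - |grad H|^2 u(X) u(Y) u(Z) d/dr, which is symmetric in X and Y.  Only
    second derivatives of H are left, hence constant components. *)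
Lemma curvopE p X Y Z :
  curvop g p X Y Z
  = row4 0 (b Y Z * X 0 c1 - b X Z * Y 0 c1)
      ((b X (coordv R c3) * Y 0 c1 - b Y (coordv R c3) * X 0 c1) * Z 0 c1)
      ((b X (coordv R c4) * Y 0 c1 - b Y (coordv R c4) * X 0 c1) * Z 0 c1).
Proof.
rewrite curvop_christoffel !derive_christoffel !christoffelE !coordvE.
by apply: row4P; rewrite !(mxE, row4E) /transverse /dH !(mxE, row4E) /=; ring.
Qed.

(** * Curvature tensors as wave tensors *)

(** The common form of R and C, a product (u tensor u) wedge beta. *)
Definition wave_tensor (b33 b44 b34 : R) : tensor4 R :=
  Kulkarni_Nomizu (fun _ X Y => X 0 c1 * Y 0 c1)
    (fun _ => transverse b33 b44 b34).

Lemma RiemE : Riem g = wave_tensor (2 * a1) (2 * a2) a3.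
Proof.
apply/funext => p; do 4!apply/funext => ?.
rewrite /Riem gdotE curvopE !row4E !coordvE.
by rewrite /wave_tensor /Kulkarni_Nomizu /transverse !row4E; ring.
Qed.

Lemma RicE : Ric g = fun _ X Y => 2 * (a1 + a2) * (X 0 c1 * Y 0 c1).
Proof.
apply/funext => p; apply/funext => Y; apply/funext => Z.
by rewrite /Ric trace_lin1_mx !curvopE !coordvE /transverse !row4E; ring.
Qed.

Lemma Ricop_waveE p X :
  Ricop g p X = row4 0 (2 * (a1 + a2) * X 0 c1) 0 0.
Proof. by rewrite /Ricop sharpE RicE !coordvE !row4E; congr row4; ring. Qed.

Lemma scal_eq0 p : scal g p = 0.
Proof.
rewrite /scal trace_lin1_mx !Ricop_waveE !coordvE !row4E.
by rewrite mulr0 !addr0.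
Qed.

(** In the product with u tensor u, the terms of g that have a factor u cancel,
    so that half of g wedge S subtracts from the Hessian half of its trace times
    the Euclidean form of the transverse plane. *)
Lemma ConformalE : Conformal g = wave_tensor (a1 - a2) (a2 - a1) a3.
Proof.
apply/funext => p; do 4!apply/funext => ?.
rewrite /Conformal scal_eq0 mul0r mul0r addr0 RiemE RicE /wave_tensor.
by rewrite /Kulkarni_Nomizu !gdotE /transverse; field.
Qed.

Lemma endo_RiemE p X Y Z : endo g (Riem g) p X Y Z = curvop g p X Y Z.
Proof.
rewrite /endo sharpE RiemE curvopE /wave_tensor /Kulkarni_Nomizu !coordvE.
by rewrite /transverse !row4E; congr row4; ring.
Qed.

(** * Properties common to all wave tensors *)

(** Each term of the product has two factors u; with a third one,
    antisymmetrization over three slots must vanish. *)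
Lemma wave_tensor_cyclic b33 b44 b34 p X1 X2 X3 X4 X5 :
  X1 0 c1 * wave_tensor b33 b44 b34 p X2 X3 X4 X5
  + X2 0 c1 * wave_tensor b33 b44 b34 p X3 X1 X4 X5
  + X3 0 c1 * wave_tensor b33 b44 b34 p X1 X2 X4 X5 = 0.
Proof. by rewrite /wave_tensor /Kulkarni_Nomizu; ring. Qed.

(** The components are constant, and the transverse part of the Christoffel map
    is u(X) u(Y) times a vector, so it sends beta to a symmetrized product of u
    and a covector, which the product with u tensor u annihilates. *)
Lemma wave_tensor_parallel b33 b44 b34 p X X1 X2 X3 X4 :
  nabla4 g (wave_tensor b33 b44 b34) p X X1 X2 X3 X4 = 0.
Proof.
rewrite /nabla4 (_ : 'D_X _ p = 0); last exact: derive_cst.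
by rewrite !christoffelE /wave_tensor /Kulkarni_Nomizu /transverse !row4E; ring.
Qed.

(** R(X, Y) Z lies in the kernel of u and its transverse part is u(Z) times a
    vector independent of Z, so that it acts on beta as the Christoffel map. *)
Lemma wave_tensor_semisymmetric b33 b44 b34 p X1 X2 X3 X4 X Y :
  act4 g (Riem g) (wave_tensor b33 b44 b34) p X1 X2 X3 X4 X Y = 0.
Proof.
rewrite /act4 !endo_RiemE !curvopE /wave_tensor /Kulkarni_Nomizu !coordvE.
by rewrite /transverse !row4E; ring.
Qed.

(** For S = t u tensor u, the operator of S in X and Y sends Z to
    t u(Z) (u(Y) X - u(X) Y), and u(Y) X - u(X) Y lies in the kernel of u. *)
Lemma wave_tensor_Tachibana b33 b44 b34 p X1 X2 X3 X4 X Y :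
  Tachibana4 (Ric g) (wave_tensor b33 b44 b34) p X1 X2 X3 X4 X Y = 0.
Proof.
rewrite /Tachibana4 /wedgeop RicE /wave_tensor /Kulkarni_Nomizu.
by rewrite /transverse !mxE; ring.
Qed.

(** * The Ricci and projective tensors *)

Lemma Ric_parallel p X X1 X2 : nabla2 g (Ric g) p X X1 X2 = 0.
Proof.
rewrite /nabla2 RicE (_ : 'D_X _ p = 0); last exact: derive_cst.
by rewrite !christoffelE !row4E; ring.
Qed.

Lemma Ric_semisymmetric p X1 X2 X Y : act2 g (Riem g) (Ric g) p X1 X2 X Y = 0.
Proof. by rewrite /act2 !endo_RiemE !curvopE RicE !row4E; ring. Qed.

(** The metric enters P in an expression that is antisymmetric in X1 and X2;
    this removes the terms with H, and the components of P are constant. *)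
Lemma ProjectiveE : Projective g = fun p X1 X2 X3 X4 =>
  wave_tensor (2 * a1) (2 * a2) a3 p X1 X2 X3 X4
  - 3^-1 * (2 * (a1 + a2)) * X3 0 c1
    * (X2 0 c1 * (X1 0 c2 * X4 0 c1 + X1 0 c3 * X4 0 c3 + X1 0 c4 * X4 0 c4)
       - X1 0 c1
         * (X2 0 c2 * X4 0 c1 + X2 0 c3 * X4 0 c3 + X2 0 c4 * X4 0 c4)).
Proof.
apply/funext => p; do 4!apply/funext => ?.
by rewrite /Projective RiemE RicE !gdotE; field.
Qed.

Lemma Projective_parallel p X X1 X2 X3 X4 :
  nabla4 g (Projective g) p X X1 X2 X3 X4 = 0.
Proof.
have Pconst : (fun q => Projective g q X1 X2 X3 X4)
    = cst (Projective g p X1 X2 X3 X4).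
  by apply/funext => q; rewrite ProjectiveE.
rewrite /nabla4 Pconst derive_cst ProjectiveE.
rewrite !christoffelE /wave_tensor /Kulkarni_Nomizu /transverse /dH !coordvE.
by rewrite !row4E; ring.
Qed.

Lemma Projective_semisymmetric p X1 X2 X3 X4 X Y :
  act4 g (Riem g) (Projective g) p X1 X2 X3 X4 X Y = 0.
Proof.
rewrite /act4 !endo_RiemE ProjectiveE !curvopE /wave_tensor /Kulkarni_Nomizu.
by rewrite !coordvE /transverse !row4E; ring.
Qed.

(** * Rank, Hessian and the form dx *)

Lemma Ric_mxE p : Ric_mx g p = (2 * (a1 + a2)) *: delta_mx c1 c1.
Proof.
apply/matrixP => i j; rewrite !mxE RicE /coordv !mxE !eqxx /=.
by rewrite -natrM mulnb [c1 == i]eq_sym [c1 == j]eq_sym.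
Qed.

Lemma partial2E i j p : partial2 i j H p = b (coordv R j) (coordv R i).
Proof.
rewrite /partial2 /partial -(derive_dH p).
by congr ('D_ _ _ p); apply/funext => q; rewrite derive_waveH.
Qed.

Lemma hessian_traceE p :
  partial2 c3 c3 H p + partial2 c4 c4 H p = 2 * (a1 + a2).
Proof. by rewrite !partial2E !coordvE /transverse !row4E; ring. Qed.

Lemma hessian_tracefreeE p :
  4 * partial2 c3 c4 H p ^+ 2 + (partial2 c3 c3 H p - partial2 c4 c4 H p) ^+ 2
  = 4 * (a3 ^+ 2 + (a1 - a2) ^+ 2).
Proof. by rewrite !partial2E !coordvE /transverse !row4E; ring. Qed.

(** Evaluating at d/dx in the outer slots recovers beta. *)
Lemma wave_tensor_eq0 b33 b44 b34 p :
  wave_tensor b33 b44 b34 p =1 (fun=> fun=> fun=> fun=> 0) ->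
  [/\ b33 = 0, b44 = 0 & b34 = 0].
Proof.
move=> T0.
have T1 i j : wave_tensor b33 b44 b34 p (coordv R c1) (coordv R i) (coordv R j)
    (coordv R c1) = 0 by rewrite T0.
have := (T1 c3 c3, T1 c4 c4, T1 c3 c4).
rewrite /wave_tensor /Kulkarni_Nomizu /transverse !coordvE !row4E.
rewrite !(mulr0, mul0r, mulr1, mul1r, addr0, add0r, subr0).
by move=> [[-> ->] ->].
Qed.

Lemma Ric_wedge_Ric p X1 X2 X3 X4 :
  Kulkarni_Nomizu (Ric g) (Ric g) p X1 X2 X3 X4 = 0.
Proof. by rewrite /Kulkarni_Nomizu RicE; ring. Qed.

Lemma dx_parallel p X X1 : nabla1 g (@dxform R) p X X1 = 0.
Proof.
have dxX1 : (fun q => feval (@dxform R) q X1) = cst (X1 0 c1).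
  by apply/funext => q; rewrite feval_dx.
by rewrite /nabla1 dxX1 derive_cst feval_dx christoffelE row4E subr0.
Qed.

Lemma dx_null p : fnorm g (@dxform R) p = 0.
Proof.
rewrite /fnorm wave_invmx mxE sum4 !mxE !sum4 !mxE /=.
by apply/eqP; rewrite sqrtr_eq0 normr_le0; apply/eqP; ring.
Qed.

Lemma Ric2_eq0 p X Y : Ric2 g p X Y = 0.
Proof. by rewrite /Ric2 RicE Ricop_waveE row4E; ring. Qed.

End GeneralizedPlaneWave.

Theorem corollary4p3 (R : realType) (M : set 'rV[R]_4)
    (Mopen : open M) (Mconnected : connected M) (Mnonempty : M !=set0)
    (a1 a2 a3 a4 a5 a6 : R) :
  let H := waveH a1 a2 a3 a4 a5 a6 in
  let g := wave_metric H in
  let S := Ric g in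
  let trH := fun p => partial2 c3 c3 H p + partial2 c4 c4 H p in
  let tfH := fun p => 4 * partial2 c3 c4 H p ^+ 2
                      + (partial2 c3 c3 H p - partial2 c4 c4 H p) ^+ 2 in
  ( {in M, forall p, scal g p = 0}
    /\ {in M, Riem g =1 Concircular g}
    /\ {in M, Conformal g =1 Conharmonic g}
    /\ venzi_space M (Riem g) (@dxform R)
    /\ venzi_space M (Conformal g) (@dxform R)
    /\ recurrent_2forms M g (Riem g) (@dxform R)
    /\ {in M, act4 g (Riem g) (Riem g) =1 0}
    /\ {in M, act2 g (Riem g) S =1 0}
    /\ {in M, act4 g (Riem g) (Conformal g) =1 0}
    /\ {in M, act4 g (Riem g) (Projective g) =1 0}
    /\ ({in M, forall p, tfH p != 0} ->
          exists Pi, recurrent_2forms M g (Conformal g) Pi)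
    /\ ({in M, forall p, trH p != 0} ->
          [/\ exists Pi, ricci_recurrent M g Pi,
              exists Pi Om T, weakly_ricci_symmetric M g Pi Om T
            & exists Pi Om T, weakly_cyclic_ricci_symmetric M g Pi Om T])
    /\ (exists2 alpha : 'rV[R]_4 -> R, smooth_on M alpha &
          {in M, forall p, forall X Y : 'rV[R]_4,
             S p X Y = alpha p * (feval (@dxform R) p X * feval (@dxform R) p Y)})
    /\ {in M, forall p, fnorm g (@dxform R) p = 0}
    /\ {in M, nabla1 g (@dxform R) =1 0}
    /\ {in M, Kulkarni_Nomizu S S =1 0}
    /\ {in M, Ric2 g =1 0}
    /\ {in M, Tachibana4 S (Riem g) =1 0}
    /\ {in M, Tachibana4 S (Conformal g) =1 0}
    /\ ({in M, forall p, trH p != 0} ->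
          {in M, forall p, \rank (Ric_mx g p) = 1%N}
          /\ ~ scalar_multiple_on M (Riem g) (Kulkarni_Nomizu S S))
    /\ ({in M, forall p, tfH p != 0} ->
          ~ scalar_multiple_on M (Riem g) (Kulkarni_Nomizu S S)
          /\ ~ scalar_multiple_on M (Conformal g) (Kulkarni_Nomizu S S)) )
  /\
  ( {in M, nabla4 g (Riem g) =1 0}
    /\ {in M, nabla2 g S =1 0}
    /\ {in M, nabla4 g (Conformal g) =1 0}
    /\ {in M, nabla4 g (Projective g) =1 0} ).
Proof.
move=> H g S trH tfH.
have trHE p : trH p = 2 * (a1 + a2) by rewrite /trH hessian_traceE.
have tfHE p : tfH p = 4 * (a3 ^+ 2 + (a1 - a2) ^+ 2).
  by rewrite /tfH hessian_tracefreeE.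
have [p0 Mp0] := Mnonempty.
have venzi b33 b44 b34 : venzi_space M (wave_tensor b33 b44 b34) (@dxform R).
  split; first exact: smooth_oneform_cst.
  - exists p0 => //; apply/eqP => /rowP/(_ c1)/eqP.
    by rewrite /dxform !mxE !eqxx /= oner_eq0.
  - by move=> p _ X1 X2 X3 X4 X5; rewrite !feval_dx wave_tensor_cyclic.
have recurrent b33 b44 b34 :
    recurrent_2forms M g (wave_tensor b33 b44 b34) (@dxform R).
  split; first exact: smooth_oneform_cst.
  move=> p _ X1 X2 X3 X Y.
  by rewrite !wave_tensor_parallel !feval_dx wave_tensor_cyclic !addr0.
have not_multiple b33 b44 b34 : ~ [/\ b33 = 0, b44 = 0 & b34 = 0] ->
    ~ scalar_multiple_on M (wave_tensor b33 b44 b34) (Kulkarni_Nomizu S S).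
  move=> b_neq0 [f fE]; apply/b_neq0/(@wave_tensor_eq0 _ _ _ _ p0) => X1.
  by do 3!apply/funext => ?; rewrite fE// Ric_wedge_Ric mulr0.
have two_neq0 : 2 != 0 :> R by rewrite pnatr_eq0.
have trH_neq0 p : trH p != 0 -> a1 + a2 != 0.
  by rewrite trHE mulf_eq0 negb_or => /andP[].
have tfH_neq0 p : tfH p != 0 -> ~ (a3 = 0 /\ a1 - a2 = 0).
  by rewrite tfHE => /eqP tf0 [a30 a120]; apply: tf0; rewrite a30 a120; ring.
have ricci_zero : ricci_recurrent M g (cst 0).
  split; first exact: smooth_oneform_cst.
  by move=> p _ X X1 X2; rewrite Ric_parallel feval0 mul0r.
have zero_smooth : smooth_oneform M (cst 0) by exact: smooth_oneform_cst.
split; last first.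
  split; last split; last split.
  - move=> p _; rewrite RiemE; do 5!apply/funext => ?.
    exact: wave_tensor_parallel.
  - by move=> p _; do 3!apply/funext => ?; exact: Ric_parallel.
  - move=> p _; rewrite ConformalE; do 5!apply/funext => ?.
    exact: wave_tensor_parallel.
  - by move=> p _; do 5!apply/funext => ?; exact: Projective_parallel.
split; first by move=> p _; exact: scal_eq0.
split.
  move=> p _; do 4!apply/funext => ?.
  by rewrite /Concircular scal_eq0 !mul0r subr0.
split.
  move=> p _; do 4!apply/funext => ?.
  by rewrite /Conformal scal_eq0 !mul0r addr0.
split; first by rewrite RiemE.
split; first by rewrite ConformalE.
split; first by rewrite RiemE.
split.
  move=> p _; rewrite [X in act4 _ _ X]RiemE; do 6!apply/funext => ?.
  exact: wave_tensor_semisymmetric.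
split; first by move=> p _; do 4!apply/funext => ?; exact: Ric_semisymmetric.
split.
  move=> p _; rewrite ConformalE; do 6!apply/funext => ?.
  exact: wave_tensor_semisymmetric.
split.
  by move=> p _; do 6!apply/funext => ?; exact: Projective_semisymmetric.
split; first by move=> _; exists (@dxform R); rewrite ConformalE.
split.
  move=> _; split; first by exists (cst 0).
  - exists (cst 0), (cst 0), (cst 0); split; [by []..|] => p _ X X1 X2.
    by rewrite Ric_parallel !feval0 RicE; ring.
  - exists (cst 0), (cst 0), (cst 0); split; [by []..|] => p _ X X1 X2.
    by rewrite !Ric_parallel !feval0 RicE; ring.
split.
  exists (cst (2 * (a1 + a2))); first exact: smooth_cst.
  by move=> p _ X Y; rewrite /S RicE !feval_dx.
split; first by move=> p _; exact: dx_null.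
split; first by move=> p _; do 2!apply/funext => ?; exact: dx_parallel.
split; first by move=> p _; do 4!apply/funext => ?; exact: Ric_wedge_Ric.
split; first by move=> p _; do 2!apply/funext => ?; exact: Ric2_eq0.
split.
  move=> p _; rewrite RiemE; do 6!apply/funext => ?.
  exact: wave_tensor_Tachibana.
split.
  move=> p _; rewrite ConformalE; do 6!apply/funext => ?.
  exact: wave_tensor_Tachibana.
split=> [trH0|tfH0].
  have t0 : a1 + a2 != 0 by apply/(trH_neq0 p0)/trH0/mem_set.
  split=> [p _|].
    by rewrite Ric_mxE mxrank_scale_nz ?mxrank_delta// mulf_neq0.
  rewrite RiemE; apply: not_multiple => -[a10 a20 _].
  move/eqP: t0; apply; apply: (mulfI two_neq0).
  by rewrite mulrDr a10 a20 addr0 mulr0.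
have a_neq0 := tfH_neq0 _ (tfH0 _ (mem_set Mp0)).
split; [rewrite RiemE | rewrite ConformalE]; apply: not_multiple.
  move=> [a10 a20 a30]; apply: a_neq0; split=> //.
  by apply: (mulfI two_neq0); rewrite mulrBr a10 a20 subr0 mulr0.
by move=> [a120 _ a30]; apply: a_neq0.
Qed.
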